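(* For all integers $k\ge 0$ and $n\ge k+2$, $$\sum_{l=0}^k\left\{{n-1\atop n-l-1}\right\}_{n-k-1}c_{n-l}^{(-k)}=0.$$
   Context: For an integer $k$, the poly-Cauchy numbers $c_n^{(k)}$ are defined by $\mathrm{Lif}_k(\log(1+x))=\sum_{n\ge0}c_n^{(k)}x^n/n!$, where $\mathrm{Lif}_k(z)=\sum_{m\ge0}\frac{z^m}{m!(m+1)^k}$; thus $c_n^{(-k)}$ uses $\mathrm{Lif}_{-k}(z)=\sum_{m\ge0}\frac{(m+1)^k z^m}{m!}$. For $r\ge 0$, the $r$-Stirling number of the second kind $\left\{{n\atop m}\right\}_r$ is the number of ways to partition $\{1,\dots,n\}$ into $m$ nonempty disjoint blocks such that $1,\dots,r$ lie in distinct blocks; equivalently $\left\{{n\atop m}\right\}_r=0$ for $n<r$, $\left\{{r\atop m}\right\}_r=\delta_{m,r}$, and $\left\{{n\atop m}\right\}_r=m\left\{{n-1\atop m}\right\}_r+\left\{{n-1\atop m-1}\right\}_r$ for $n>r$. *)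

(* Defs.v *)
From mathcomp Require Import all_boot all_order all_algebra.

Set Implicit Arguments.
Unset Strict Implicit.
Unset Printing Implicit Defensive.

Import Order.TTheory GRing.Theory Num.Theory.
Local Open Scope ring_scope.

(* A formal power series over the rationals is its coefficient sequence:
   [f n] is the coefficient of x^n. *)
Definition fps := nat -> rat.

Definition fps_one : fps := fun n => (n == 0%N)%:R.

Definition fps_mul (f g : fps) : fps :=
  fun n => \sum_(i < n.+1) f i * g (n - i)%N.

Definition fps_exp (f : fps) (m : nat) : fps := iter m (fps_mul f) fps_one.

(* The series f(g(x)), meant for g without constant term: then g^m has no
   coefficient below x^m, so that only the terms m <= n of
   f(g(x)) = \sum_m f_m g(x)^m contribute to x^n. *)
Definition fps_comp (f g : fps) : fps :=
  fun n => \sum_(m < n.+1) f m * fps_exp g m n.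

(* log(1+x) = \sum_(n >= 1) (-1)^(n-1) x^n / n *)
Definition log1p : fps :=
  fun n => if n is n'.+1 then (-1) ^+ n' / n%:R else 0.

(* Lif_k(z) = \sum_m z^m / (m! (m+1)^k) *)
Definition Lif (k : int) : fps :=
  fun m => (m`!%:R * m.+1%:R ^ k)^-1.

(* c_n^(k), where Lif_k(log(1+x)) = \sum_n c_n^(k) x^n / n! *)
Definition polyCauchy (k : int) (n : nat) : rat :=
  n`!%:R * fps_comp (Lif k) log1p n.

(* The r-Stirling number of the second kind {n, m}_r. The ground set {1,...,n}
   is 'I_n, so 1,...,r become the elements of value < r; [partition] already
   requires the blocks to be nonempty. The number is 0 when n < r. *)
Definition rStirling2 (r n m : nat) : nat :=
  if (n < r)%N then 0%N else
  #|[set P : {set {set 'I_n}} |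
      [&& partition P [set: 'I_n], #|P| == m &
          [forall i : 'I_n, forall j : 'I_n,
             [&& (i < r)%N, (j < r)%N & i != j] ==>
               (pblock P i != pblock P j)]]]|.

(* Main.v *)
(** Write (x)_m for the falling factorial and T p = (x p)'. Since
    log(1+x)^m / m! generates the signed Stirling numbers of the first kind,
    and T multiplies the coefficient of x^m by m + 1, one has
    c_n^(-k) = (T^k (x)_n)(1).
    Counting the maps from r + k points to y points that are injective on the
    first r points according to the partition into fibres gives
    \sum_m {r+k, m}_r (y)_m = (y)_r y^k.
    Put r = n - k - 1 >= 1 and y = x - 1. As (x)_(m+1) = x (x-1)_m, the sum in
    question is T^k, evaluated at 1, of x (x-1)_r (x-1)^k. This polynomial
    vanishes to order k + 1 at 1, and T^k lowers the order by at most k. *)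

Require Import Defs.
From mathcomp Require Import all_boot all_order all_algebra.

Import GRing.Theory Num.Theory.
Local Open Scope ring_scope.

(** * Maps counted through their fibre partitions *)

Lemma preim_partition_eqP (T : finType) (U : eqType) (f : T -> U)
    (P : {set {set T}}) : partition P [set: T] ->
  reflect (forall x y, (f x == f y) = (pblock P x == pblock P y))
          (preim_partition f [set: T] == P).
Proof.
move=> partP; have [/eqP covP triP _] := and3P partP.
apply: (iffP eqP) => [<- x y | eqfP].
  have [/eqP cov tri _] := and3P (preim_partitionP f [set: T]).
  rewrite eq_pblock ?cov // pblock_equivalence_partition //.
  by split=> //= /eqP->.
rewrite -(preim_partition_pblock partP) /preim_partition.
by apply: eq_imset => x; apply/setP=> y; rewrite !inE eqfP.
Qed.

(** A map with fibre partition [P] factors uniquely as the projection to blocks followed by an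
    injection of the blocks into [U]; [lift] is this correspondence. *)
Lemma card_ffun_preim_partition (T U : finType) (P : {set {set T}}) :
  partition P [set: T] ->
  #|[set f : {ffun T -> U} | preim_partition f [set: T] == P]| = #|U| ^_ #|P|.
Proof.
move=> partP; have [/eqP covP triP P0] := and3P partP.
have blockP x : pblock P x \in P by rewrite pblock_mem ?covP.
pose block x : {B | B \in P} := exist _ (pblock P x) (blockP x).
have memB (B : {B | B \in P}) : exists x, x \in val B.
  by apply/set0Pn; apply: contraNneq P0 => <-; apply: valP.
(* A section of [block], used to read the injection on blocks off a given map. *)
pose rep B := xchoose (memB B).
have blockK B : block (rep B) = B.
  by apply: val_inj; apply: def_pblock (valP B) (xchooseP (memB B)).
rewrite -(card_sig (mem P)) -card_inj_ffuns.
pose lift (g : {ffun {B | B \in P} -> U}) := [ffun x => g (block x)].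
have lift_inj : injective lift.
  move=> g h /ffunP eqgh; apply/ffunP=> B.
  by have := eqgh (rep B); rewrite !ffunE blockK.
rewrite -(card_imset _ lift_inj); apply: eq_card => f; rewrite !inE.
apply/preim_partition_eqP/imsetP=> // [eqfP | [g]]; last first.
  rewrite inE => /injectiveP g_inj -> x y.
  by rewrite !ffunE (inj_eq g_inj) -val_eqE.
exists [ffun B => f (rep B)].
  rewrite inE; apply/injectiveP=> B C; rewrite !ffunE => /eqP.
  by rewrite eqfP => /eqP eqBC; rewrite -[B]blockK -[C]blockK; apply: val_inj.
apply/ffunP=> x; rewrite !ffunE; apply/eqP.
by rewrite eqfP -[pblock P (rep _)]/(val (block _)) blockK.
Qed.

Definition separates {n} (r : nat) (P : {set {set 'I_n}}) : bool :=
  [forall i : 'I_n, forall j : 'I_n,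
     [&& (i < r)%N, (j < r)%N & i != j] ==> (pblock P i != pblock P j)].

Lemma separates_preim_partition r k (U : eqType) (f : 'I_(r + k) -> U) :
  separates r (preim_partition f [set: 'I_(r + k)])
    = injectiveb (f \o lshift k).
Proof.
have partP := preim_partitionP f [set: 'I_(r + k)].
have eqf := elimT (preim_partition_eqP _ _ f _ partP) (eqxx _).
apply/'forall_forallP/injectiveP => [sepP i j /= /eqP | f_inj i j].
  rewrite eqf; apply: contraTeq => neq_ij.
  by have:= sepP (lshift k i) (lshift k j); rewrite /= !ltn_ord eq_lshift neq_ij.
apply/implyP=> /and3P[ir jr]; rewrite -eqf; apply: contraNN => /eqP eqij.
have E (u : 'I_(r + k)) (ur : (u < r)%N) : u = lshift k (Ordinal ur).
  exact: val_inj.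
by rewrite (E i ir) (E j jr) eq_lshift; apply/eqP/f_inj; rewrite /= -!E.
Qed.

(** Such a map is a pair: an injection on the first [r] points and an arbitrary map on the other
    [k], joined by [glue]. *)
Lemma card_ffun_inj_lshift r k (U : finType) :
  #|[set f : {ffun 'I_(r + k) -> U} | injectiveb (f \o lshift k)]|
    = (#|U| ^_ r * #|U| ^ k)%N.
Proof.
pose glue (gh : {ffun 'I_r -> U} * {ffun 'I_k -> U}) : {ffun 'I_(r + k) -> U} :=
  [ffun i => match split i with inl u => gh.1 u | inr v => gh.2 v end].
have glueL gh i : glue gh (lshift k i) = gh.1 i.
  by rewrite ffunE; have /= -> := unsplitK (inl i : 'I_r + 'I_k).
have glueR gh i : glue gh (rshift r i) = gh.2 i.
  by rewrite ffunE; have /= -> := unsplitK (inr i : 'I_r + 'I_k).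
have glue_inj : injective glue.
  move=> [g h] [g' h'] eq_glue; congr pair; apply/ffunP=> i.
    by rewrite -[g]/(g, h).1 -glueL eq_glue glueL.
  by rewrite -[h]/(g, h).2 -glueR eq_glue glueR.
rewrite -[in (_ ^_ r)%N](card_ord r) -card_inj_ffuns.
rewrite -[in (_ ^ k)%N](card_ord k) -card_ffun -cardsT -cardsX.
rewrite -(card_imset _ glue_inj); apply: eq_card => f; rewrite !inE.
apply/injectiveP/imsetP => [f_inj | [[g h]]]; last first.
  rewrite !inE andbT => /injectiveP g_inj -> i j /=.
  by rewrite !glueL; apply: g_inj.
exists ([ffun i => f (lshift k i)], [ffun i => f (rshift r i)]).
  rewrite !inE andbT; apply/injectiveP=> i j; rewrite !ffunE; exact: f_inj.
apply/ffunP=> i; rewrite -[i]splitK; case: (split i) => u /=.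
  by rewrite glueL ffunE.
by rewrite glueR ffunE.
Qed.

Lemma partition_card_le (T : finType) (P : {set {set T}}) D :
  partition P D -> (#|P| <= #|D|)%N.
Proof.
move=> partP; rewrite -(card_transversal (transversalP partP)) subset_leq_card //.
exact: transversal_sub (transversalP partP).
Qed.

Lemma rStirling2E r k m : rStirling2 r (r + k) m =
  #|[set P : {set {set 'I_(r + k)}} |
      [&& partition P [set: 'I_(r + k)], #|P| == m & separates r P]]|.
Proof. by rewrite /rStirling2 ltnNge leq_addr. Qed.

(** The first [r] points occupy [r] distinct blocks, so fewer blocks are impossible. *)
Lemma rStirling2_small r k m : (m < r)%N -> rStirling2 r (r + k) m = 0%N.
Proof.
move=> ltmr; rewrite rStirling2E; apply/eqP; rewrite cards_eq0.
apply/eqP/setP=> P; rewrite !inE; apply/and3P=> -[partP /eqP cardP sepP].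
have [/eqP covP _ _] := and3P partP.
have inj : injective (pblock P \o lshift k).
  (* The fibre partition of [pblock P] is [P] itself. *)
  by apply/injectiveP; rewrite -separates_preim_partition preim_partition_pblock.
suff : (r <= #|P|)%N by rewrite cardP leqNgt ltmr.
rewrite -[r in (r <= _)%N](card_ord r) -cardsT -(card_imset _ inj).
rewrite subset_leq_card //.
by apply/subsetP=> _ /imsetP[i _ ->]; rewrite pblock_mem ?covP.
Qed.

Lemma sum_rStirling2_ffact r k y :
  (\sum_(m < (r + k).+1) rStirling2 r (r + k) m * y ^_ m = y ^_ r * y ^ k)%N.
Proof.
rewrite -[in RHS](card_ord y) -card_ffun_inj_lshift -[RHS]sum1dep_card.
pose good (P : {set {set 'I_(r + k)}}) :=
  partition P [set: 'I_(r + k)] && separates r P.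
pose kernel (f : {ffun 'I_(r + k) -> 'I_y}) :=
  preim_partition f [set: 'I_(r + k)].
rewrite (partition_big kernel good) /=; last first.
  by move=> f; rewrite /good preim_partitionP separates_preim_partition.
transitivity (\sum_(P | good P) y ^_ #|P|)%N; last first.
  apply: eq_bigr => P /andP[partP sepP].
  rewrite sum1dep_card -[in LHS](card_ord y) -card_ffun_preim_partition //.
  apply: eq_card => f; rewrite !inE andb_idl // => /eqP kerE.
  by rewrite -separates_preim_partition -/(kernel f) kerE.
(* A partition of r + k points has at most r + k blocks, so [inord] never takes its default value on
   [good] partitions. *)
pose blocks (P : {set {set 'I_(r + k)}}) : 'I_(r + k).+1 := inord #|P|.
rewrite (partition_big blocks xpredT) //=.
apply: eq_bigr => m _; rewrite rStirling2E -sum_nat_cond_const.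
apply: eq_big => P; rewrite ?inE; last by case/and3P=> _ /eqP->.
rewrite /good -andbA; case partP: (partition P _) => //=; rewrite andbC.
congr (_ && _); rewrite -val_eqE /= inordK // ltnS.
by rewrite -[X in (_ <= X)%N]card_ord -cardsT partition_card_le.
Qed.

(** * Falling factorials as polynomials *)

Definition ffact_poly (n : nat) : {poly rat} := \prod_(i < n) ('X - i%:R%:P).

Lemma ffact_polyS n : ffact_poly n.+1 = ffact_poly n * ('X - n%:R%:P).
Proof. exact: big_ord_recr. Qed.

Lemma ffact_poly_shift n : ffact_poly n.+1 = 'X * (ffact_poly n \Po ('X - 1)).
Proof.
rewrite /ffact_poly big_ord_recl subr0 rmorph_prod; congr (_ * _).
apply: eq_bigr => i _ /=; rewrite comp_polyB comp_polyX comp_polyC /bump /=.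
by rewrite natrD polyCD opprD addrA.
Qed.

Lemma size_ffact_poly n : size (ffact_poly n) = n.+1.
Proof.
rewrite size_prod_XsubC /index_enum; case: index_enum_key.
by rewrite -enumT size_enum_ord.
Qed.

Lemma horner_ffact_poly n y : (ffact_poly n).[y%:R] = (y ^_ n)%:R.
Proof.
elim: n => [|n IHn]; first by rewrite /ffact_poly big_ord0 hornerC.
rewrite ffact_polyS hornerM IHn !hornerE ffactnSr natrM.
(* The truncated y - n is the true difference if n <= y; otherwise the factor [y ^_ n] is already
   0. *)
have [leny | ltyn] := leqP n y; first by rewrite natrB.
by rewrite ffact_small ?mul0r.
Qed.

(** The difference would have as many distinct roots as its size, one more than its degree
    allows. *)
Lemma poly_eq_on_nat (p q : {poly rat}) :
  (forall y : nat, p.[y%:R] = q.[y%:R]) -> p = q.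
Proof.
move=> eqpq; apply/eqP; rewrite -subr_eq0; apply/eqP.
pose rs := [seq i%:R : rat | i <- iota 0 (size (p - q))].
apply: (@roots_geq_poly_eq0 _ _ rs); last by rewrite size_map size_iota.
  by apply/allP=> _ /mapP[i _ ->]; rewrite rootE hornerD hornerN eqpq subrr.
by rewrite map_inj_uniq ?iota_uniq // => i j /eqP; rewrite eqr_nat => /eqP.
Qed.

(** * The operator T and vanishing at 1 *)

Definition mulX_deriv (p : {poly rat}) : {poly rat} := ('X * p)^`().

Lemma coef_iter_mulX_deriv k p m :
  (iter k mulX_deriv p)`_m = m.+1%:R ^+ k * p`_m.
Proof.
elim: k => [|k IHk] /=; first by rewrite mul1r.
by rewrite coef_deriv coefXM /= IHk -[LHS]mulr_natl mulrA exprS.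
Qed.

Lemma horner1_iter_mulX_deriv k N (p : {poly rat}) : (size p <= N)%N ->
  (iter k mulX_deriv p).[1] = \sum_(m < N) m.+1%:R ^+ k * p`_m.
Proof.
move=> szp; rewrite (@horner_coef_wide _ N).
  by apply: eq_bigr => m _; rewrite coef_iter_mulX_deriv expr1n mulr1.
apply/leq_sizeP=> m leNm; rewrite coef_iter_mulX_deriv nth_default ?mulr0 //.
exact: leq_trans leNm.
Qed.

(** One application of T turns p (x-1)^(k+2) into ((x p)' (x-1) + (k+2) x p) (x-1)^(k+1); the
    cofactor changes, so the induction is over all [p]. *)
Lemma iter_mulX_deriv_root k p :
  (iter k mulX_deriv (p * ('X - 1) ^+ k.+1)).[1] = 0.
Proof.
elim: k p => [|k IHk] p; first by rewrite expr1 /= !hornerE.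
rewrite iterSr /mulX_deriv mulrA derivM deriv_exp derivB derivX derivC subr0 mul1r.
by rewrite exprS mulrA -[in X in _ + X]mulr_natl !mulrA -mulrDl IHk.
Qed.

(** * Powers of log(1+x) and poly-Cauchy numbers *)

(** Truncation makes polynomial derivatives available and leaves the coefficients below x^N of every
    power intact. *)
Definition log1p_poly (N : nat) : {poly rat} := \poly_(i < N) log1p i.

Lemma fps_exp_log1p N m n :
  (n < N)%N -> fps_exp log1p m n = (log1p_poly N ^+ m)`_n.
Proof.
elim: m n => [|m IHm] n ltnN; first by rewrite coef1.
rewrite exprS coefM; apply: eq_bigr => i _.
rewrite coef_poly (leq_ltn_trans (leq_ord i) ltnN) -IHm //.
exact: leq_ltn_trans (leq_subr _ _) ltnN.
Qed.

(** Truncated form of (1+x) log(1+x)' = 1: the derivative is a finite geometric sum, and telescoping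
    leaves one error term. *)
Lemma log1p_poly_deriv N :
  (1 + 'X) * (log1p_poly N.+1)^`() = 1 - ((-1) ^+ N)%:P * 'X^N.
Proof.
have -> : (log1p_poly N.+1)^`() = \poly_(i < N) (-1) ^+ i.
  apply/polyP=> i; rewrite coef_deriv !coef_poly ltnS.
  by case: ifP => _; rewrite ?mul0rn // -[LHS]mulr_natr divfK // pnatr_eq0.
apply/polyP=> i; rewrite mulrDl mul1r coefD coefXM coefB coef1.
rewrite coefCM coefXn !coef_poly; case: i => [|i] /=.
  by case: N => [|N]; rewrite addr0 /= ?expr0 ?mulr1 ?mulr0 ?subrr ?subr0.
case: (ltngtP i.+1 N) => [ltiN|ltNi|<-].
- by rewrite exprS mulN1r addNr mulr0 subr0.
- by rewrite mulr0 subr0.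
- by rewrite exprS mulN1r mulr1 opprK !add0r.
Qed.

(** Coefficient of x^n in (1+x) (L^m)' = m L^(m-1) for L = log(1+x). *)
Lemma fps_exp_log1p_rec m n :
  n.+1%:R * fps_exp log1p m n.+1 + n%:R * fps_exp log1p m n
    = m%:R * fps_exp log1p m.-1 n.
Proof.
(* Truncating at n + 2 keeps the coefficients n and n + 1, and the error term, a multiple of
   x^(n+1), does not reach x^n. *)
rewrite !(fps_exp_log1p n.+2) //; set L := log1p_poly _.
have: (1 + 'X) * (L ^+ m)^`()
    = (L ^+ m.-1 - ((-1) ^+ n.+1)%:P * L ^+ m.-1 * 'X^(n.+1)) *+ m.
  rewrite deriv_exp mulrnAr mulrA log1p_poly_deriv mulrC.
  by rewrite mulrBr mulr1 mulrA [_ * _%:P]mulrC.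
move/(congr1 (fun q : {poly rat} => q`_n)).
rewrite mulrDl mul1r coefD coefXM coefMn coefB coefMXn ltnSn subr0 !coef_deriv.
by rewrite !mulr_natl; case: n @L => [|n] L /=; rewrite ?mulr0n.
Qed.

(** Both sides obey the recurrence s(n+1,m) = s(n,m-1) - n s(n,m) of the signed Stirling numbers of
    the first kind. *)
Lemma coef_ffact_poly m n :
  (ffact_poly n)`_m = n`!%:R / m`!%:R * fps_exp log1p m n.
Proof.
elim: n m => [|n IHn] m.
  rewrite /ffact_poly big_ord0 coef1 fact0 (fps_exp_log1p 1) //.
  case: m => [|m]; first by rewrite coef1.
  by rewrite exprS coef0M coef_poly /= mul0r mulr0.
rewrite ffact_polyS mulrBr coefB coefMX coefMC factS natrM.
rewrite !IHn; set b := fps_exp _ _ n; set a := fps_exp _ m n.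
have -> : n.+1%:R * n`!%:R / m`!%:R * fps_exp log1p m n.+1
    = n`!%:R / m`!%:R * (n.+1%:R * fps_exp log1p m n.+1).
  by rewrite mulrA; congr (_ * _); rewrite -mulrA mulrC.
rewrite (canRL (addrK _) (fps_exp_log1p_rec m n)) mulrBr -/a -/b.
congr (_ - _); last by rewrite [RHS]mulrCA mulrC.
(* For m = 0 the factor m removes the junk index [m.-1]; otherwise m / m! = 1 / (m-1)!. *)
case: m @b {a} => [|m] b /=; first by rewrite mul0r mulr0.
rewrite factS natrM invfM !mulrA; congr (_ * b).
by rewrite mulrAC divfK // pnatr_eq0.
Qed.

Lemma polyCauchyE k n :
  polyCauchy (- k%:Z) n = (iter k mulX_deriv (ffact_poly n)).[1].
Proof.
rewrite (horner1_iter_mulX_deriv _ n.+1) ?size_ffact_poly // /polyCauchy mulr_sumr.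
apply: eq_bigr => m _; rewrite coef_ffact_poly /Lif invfM -exprnN invrK exprnP.
by rewrite -!mulrA [RHS]mulrCA; congr (_ * _); rewrite mulrCA.
Qed.

(** * From the counting identity to the vanishing sum *)

Lemma iter_mulX_deriv_sum k N (c : nat -> rat) (p : nat -> {poly rat}) :
  iter k mulX_deriv (\sum_(i < N) c i *: p i)
    = \sum_(i < N) c i *: iter k mulX_deriv (p i).
Proof.
apply/polyP=> m; rewrite coef_iter_mulX_deriv !coef_sum mulr_sumr.
by apply: eq_bigr => i _; rewrite !coefZ coef_iter_mulX_deriv mulrCA.
Qed.

Lemma sum_rStirling2_ffact_poly r k :
  \sum_(m < (r + k).+1) (rStirling2 r (r + k) m)%:R *: ffact_poly m
    = ffact_poly r * 'X^k.
Proof.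
apply: poly_eq_on_nat => y; rewrite hornerM hornerXn horner_ffact_poly horner_sum.
rewrite -natrX -natrM -sum_rStirling2_ffact natr_sum.
by apply: eq_bigr => m _; rewrite hornerZ horner_ffact_poly natrM.
Qed.

(** Substitute x - 1 for x and multiply by x. The last factor x - 1 comes from (x-1)_(r+1) = (x-1)
    (x-2)_r, which is why the Stirling subscript is taken positive. *)
Lemma sum_rStirling2_ffact_poly_succ r k :
  \sum_(m < (r.+1 + k).+1) (rStirling2 r.+1 (r.+1 + k) m)%:R *: ffact_poly m.+1
    = 'X * ((ffact_poly r \Po ('X - 1)) \Po ('X - 1)) * ('X - 1) ^+ k.+1.
Proof.
transitivity ('X * ((ffact_poly r.+1 * 'X^k) \Po ('X - 1))).
  rewrite -sum_rStirling2_ffact_poly linear_sum mulr_sumr; apply: eq_bigr => m _ /=.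
  by rewrite comp_polyZ -scalerAr ffact_poly_shift.
rewrite ffact_poly_shift !comp_polyM comp_Xn_poly comp_polyX.
by rewrite [in LHS](mulrC ('X - 1)) -!mulrA exprS.
Qed.

Theorem theorem7 (k n : nat) (hn : (k + 2 <= n)%N) :
  \sum_(0 <= l < k.+1)
     (rStirling2 (n - k - 1) (n - 1) (n - l - 1))%:R
       * polyCauchy (- k%:Z) (n - l) = 0.
Proof.
(* From here on [r.+1] is the Stirling subscript n - k - 1. *)
have [r ->] : exists r, n = (r.+1 + k).+1.
  by exists (n - k - 2)%N; rewrite addSn -addn2 -addnA -subnDA subnK.
pose c m : rat := (rStirling2 r.+1 (r.+1 + k) m)%:R.
pose e m := (iter k mulX_deriv (ffact_poly m.+1)).[1].
transitivity (\sum_(m < (r.+1 + k).+1) c m * e m); last first.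
  pose q := 'X * ((ffact_poly r \Po ('X - 1)) \Po ('X - 1)).
  rewrite -[RHS](iter_mulX_deriv_root k q) -sum_rStirling2_ffact_poly_succ.
  rewrite (iter_mulX_deriv_sum _ _ c (fun m => ffact_poly m.+1)).
  by rewrite horner_sum; apply: eq_bigr => m _; rewrite hornerZ.
(* The full sum over m has extra terms below r + 1, which vanish. *)
have small0 : \sum_(0 <= m < r.+1) c m * e m = 0.
  rewrite big_nat big1 // => m ltmr.
  by rewrite /c rStirling2_small ?mul0r.
rewrite -(big_mkord xpredT (fun m => c m * e m)) -addnS.
rewrite [RHS](@big_cat_nat _ _ _ r.+1) ?leq_addr //= small0 add0r.
(* Shifting and reversing matches l with m = n - l - 1 = (k - l) + (r + 1). *)
rewrite -[X in index_iota X (r.+1 + _)]add0n big_addn addKn [RHS]big_nat_rev add0n.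
rewrite !big_mkord; apply: eq_bigr => j _.
have le_jk : (j <= k)%N by rewrite -ltnS.
have -> : (r.+1 + k.+1 - j = (k - j + r.+1).+1)%N.
  by rewrite addnS subSn ?(leq_trans le_jk) ?leq_addl // -addnBA // addnC.
have -> : (r.+1 + k.+1 - k - 1 = r.+1)%N.
  by rewrite subn1 addnS subSn ?leq_addl // addnK.
by rewrite polyCauchyE [(k.+1 - _)%N]subSS !subn1 addnS.
Qed.
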